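(* Let $G$ be any graph, let $l \ge 4$ be an integer, and let $H \in \mathcal{IIM}_l(G)$ be a graph with no isolated vertices (so that its normalized Laplacian is defined). Then the spectral gap $\lambda$ of $H$ satisfies $\lambda \ge \frac{1}{15}$.
   Context: Graphs are finite, simple, undirected and nonempty. $N(v)$ is the neighborhood of $v$ and $N[v]=\{v\}\cup N(v)$. The Iterated Independent Model (IIM): Given a graph $G'$, one time step adds to $G'$, for every vertex $v \in V(G')$, exactly one new vertex $v'$ (the copy of $v$), which is, by a choice made independently for each $v$, either a clone of $v$, meaning $N(v')=N[v]$, or an anticlone of $v$, meaning $N(v')=V(G')\setminus N[v]$; here $N[v]$ is taken in $G'$, no edges are added among old vertices, and the vertices added in the same step are pairwise non-adjacent. $\mathcal{IIM}_l(G)$ is the set of all graphs obtainable from $G$ by $l$ successive time steps (over all choices), with $\mathcal{IIM}_0(G)=\{G\}$. For a graph on $n$ vertices with no isolated vertices, adjacency matrix $A$ and diagonal degree matrix $D$, the normalized Laplacian is $L=I-D^{-1/2}AD^{-1/2}$, with eigenvalues $0=\lambda_0\le\lambda_1\le\cdots\le\lambda_{n-1}\le 2$. The spectral gap is $\lambda=\max\{|\lambda_1-1|,|\lambda_{n-1}-1|\}$. *)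

(* Defs.v *)
From mathcomp Require Import all_boot all_order all_algebra.
From mathcomp Require Import spectral sesquilinear complex polyrcf.

Set Implicit Arguments.
Unset Strict Implicit.
Unset Printing Implicit Defensive.

Import Order.TTheory GRing.Theory Num.Theory.
Local Open Scope ring_scope.

Record sgraph := SGraph {
  vertex :> finType;
  adj : rel vertex;
  adj_sym : symmetric adj;
  adj_irr : irreflexive adj;
  vertex_gt0 : (0 < #|vertex|)%N
}.

Definition nbh (G : sgraph) (v : G) : {set G} := [set u | adj v u].

Definition cnbh (G : sgraph) (v : G) : {set G} := v |: nbh v.

Definition no_isolated (G : sgraph) : Prop := forall v : G, nbh v != set0.

(* The vertex set of H is the disjoint union of the image of [old] (the vertices
   of G) and the image of [copy] (the new vertices).  Since N(copy v) lies in
   the image of [old], new vertices are pairwise non-adjacent. *)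
Definition iim_step (G H : sgraph) : Prop :=
  exists old copy : G -> H,
    [/\ injective old /\ injective copy,
        [disjoint codom old & codom copy]
          /\ (forall w : H, (w \in codom old) || (w \in codom copy)),
        forall u v : G, adj (old u) (old v) = adj u v
      & forall v : G, nbh (copy v) = old @: cnbh v
                   \/ nbh (copy v) = old @: (~: cnbh v)].

Fixpoint iim (l : nat) (G H : sgraph) : Prop :=
  match l with
  | 0 => H = G
  | l'.+1 => exists2 G' : sgraph, iim l' G G' & iim_step G' H
  end.

Definition adjmx (R : rcfType) (G : sgraph) : 'M[R]_#|G| :=
  \matrix_(i, j) (adj (enum_val i) (enum_val j))%:R.

Definition degmx_invsqrt (R : rcfType) (G : sgraph) : 'M[R]_#|G| :=
  diag_mx (\row_i (Num.sqrt #|nbh (enum_val i)|%:R)^-1).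

Definition norm_laplacian (R : rcfType) (G : sgraph) : 'M[R]_#|G| :=
  1%:M - degmx_invsqrt R G *m adjmx R G *m degmx_invsqrt R G.

(* The roots in R of the characteristic polynomial, in nondecreasing order and
   repeated according to multiplicity. *)
Definition eigenvalues (R : rcfType) (n : nat) (A : 'M[R]_n) : seq R :=
  flatten [seq nseq (mup x (char_poly A)) x | x <- rootsR (char_poly A)].

Lemma char_poly_eigenvalues (R : rcfType) (n : nat) (A : 'M[R]_n) :
  A^T = A -> char_poly A = \prod_(x <- eigenvalues A) ('X - x%:P).
Proof.
move=> Asym.
have [s Es] : exists s : seq R, char_poly A = \prod_(x <- s) ('X - x%:P).
  pose f : {rmorphism R -> R[i]} := real_complex R.
  pose B := map_mx f A.
  have Bh : B \is hermsymmx.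
    apply/is_hermitianmxP; rewrite expr0 scale1r /B map_trmx -!map_mx_comp.
    rewrite -{1}Asym; apply/matrixP=> i j; rewrite !mxE /=.
    by rewrite conj_Creal //; apply/complex_realP; exists (A j i).
  have /orthomx_spectralP E := hermitian_normalmx Bh.
  have Dr := hermitian_spectral_diag_real Bh.
  exists [seq complex.Re (spectral_diag B 0 i) | i <- enum 'I_n].
  apply: (map_poly_inj f); rewrite map_char_poly -/B.
  rewrite rmorph_prod big_map big_enum /=.
  have -> : char_poly B = char_poly (diag_mx (spectral_diag B)).
    have U := unitarymx_unit (spectral_unitarymx B).
    set P := spectralmx B in E U; set D := diag_mx _ in E *.
    have EM : char_poly_mx B =
        map_mx polyC (invmx P) *m char_poly_mx D *m map_mx polyC P.
      rewrite {1}E /char_poly_mx mulmxBr mulmxBl !map_mxM; congr (_ - _).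
      by rewrite scalar_mxC -mulmxA -map_mxM mulVmx // map_mx1 mulmx1.
    rewrite /char_poly EM !det_mulmx mulrAC -det_mulmx -map_mxM mulVmx //.
    by rewrite map_mx1 det1 mul1r.
  rewrite char_poly_trig; last by apply: diag_mx_is_trig.
  apply: eq_bigr => i _; rewrite rmorphB /= map_polyX map_polyC /= mxE eqxx.
  by rewrite mulr1n /f /= RRe_real //; apply: (mxOverP Dr).
have p0 : char_poly A != 0 by rewrite monic_neq0 ?char_poly_monic.
rewrite [LHS]Es; apply: perm_big; apply/allP=> x _ /=; apply/eqP.
rewrite -mu_prod_XsubC -Es /eigenvalues count_flatten -map_comp.
have rP y : (y \in rootsR (char_poly A)) = root (char_poly A) y.
  by have := roots_on_rootsR p0 y; rewrite in_itv.
have U : uniq (rootsR (char_poly A)) by rewrite /rootsR uniq_roots.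
rewrite sumnE big_map; under eq_bigr => y _ do rewrite /= count_nseq /=.
have [xr|xr] := boolP (x \in rootsR (char_poly A)).
  rewrite (bigD1_seq x) //= eqxx mul1n big1 ?addn0 // => y /negPf->.
  by rewrite mul0n.
rewrite big1_seq ?mupNroot -?rP // => y /= yr; case: eqVneq yr xr => [->->//|].
by rewrite mul0n.
Qed.

Lemma sorted_eigenvalues (R : rcfType) (n : nat) (A : 'M[R]_n) :
  sorted <=%R (eigenvalues A).
Proof.
rewrite sorted_pairwise; last exact: le_trans. rewrite /eigenvalues.
have : pairwise <%R (rootsR (char_poly A)).
  by rewrite -sorted_pairwise ?sorted_roots //; exact: lt_trans.
elim: (rootsR _) => //= x s IH /andP[/allP lt_xs /IH{}IH].
rewrite pairwise_cat IH andbT; apply/andP; split.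
  apply/allrelP=> y z /nseqP[-> _] /flattenP[t /mapP[u us ->] /nseqP[-> _]].
  exact/ltW/lt_xs.
by elim: (mup _ _) => //= k ->; rewrite andbT; apply/allP=> y /nseqP[->].
Qed.

Lemma norm_laplacian_sym (R : rcfType) (G : sgraph) :
  (norm_laplacian R G)^T = norm_laplacian R G.
Proof.
rewrite /norm_laplacian linearB /= trmx1 !trmx_mul tr_diag_mx mulmxA.
by congr (_ - _ *m _ *m _); apply/matrixP=> i j; rewrite !mxE adj_sym.
Qed.

Lemma size_spectrum (R : rcfType) (G : sgraph) :
  size (eigenvalues (norm_laplacian R G)) = #|G|.
Proof.
have := size_char_poly (norm_laplacian R G).
by rewrite char_poly_eigenvalues ?norm_laplacian_sym // size_prod_XsubC => -[].
Qed.

Definition lambda (R : rcfType) (G : sgraph) (k : nat) : R :=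
  nth 0 (eigenvalues (norm_laplacian R G)) k.

Definition spectral_gap (R : rcfType) (G : sgraph) : R :=
  Num.max `|lambda R G 1 - 1| `|lambda R G #|G|.-1 - 1|.

(* Main.v *)
(** Let H arise from G' in the last time step, let x be the sum of the degrees
    in H of the copies, and y the sum of the degrees in G'.  The copies are
    independent in H, and the sum of the degrees in H of the old vertices is
    x + y.  The Rayleigh quotient of the normalized Laplacian at D^{1/2} f, with
    f equal to x + y on copies and to -x on old vertices (so D^{1/2} f is
    orthogonal to the 0-eigenvector), is 1 + x / (x + y); hence
    lambda_{n-1} - 1 >= x / (x + y).

    It remains to see y <= 14 x.  A vertex of degree d in G' has a copy of degree
    d + 1 or |G'| - 1 - d, so only vertices with d close to |G'| are cheap.  But
    G' is itself obtained in one step from some G'', so its new vertices have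
    degree at most |G''| = |G'|/2, and an old vertex of large degree in G' is
    adjacent to many new ones; it can be charged to the degrees of these. *)

Require Import Defs.
From mathcomp Require Import all_boot all_order all_algebra.
From mathcomp Require Import spectral sesquilinear complex polyrcf.
From mathcomp Require Import zify ring lra.

Set Implicit Arguments.
Unset Strict Implicit.
Unset Printing Implicit Defensive.

Import Order.TTheory GRing.Theory Num.Theory.
Local Open Scope ring_scope.
Local Open Scope sesquilinear_scope.

(** * Rayleigh quotients of symmetric matrices and of the normalized Laplacian *)

Lemma eigenvalues_le_last (R : rcfType) (n : nat) (A : 'M[R]_n) (r : R) :
  A^T = A -> root (char_poly A) r -> r <= nth 0 (eigenvalues A) n.-1.
Proof.
move=> Asym; have sz : size (eigenvalues A) = n.
  by have := size_char_poly A; rewrite char_poly_eigenvalues // size_prod_XsubC => -[].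
rewrite char_poly_eigenvalues // root_prod_XsubC => rA.
have ltn : (index r (eigenvalues A) < n)%N by rewrite -[ltnRHS]sz index_mem.
rewrite -[leLHS](nth_index 0 rA).
apply: (sorted_leq_nth le_trans le_refl 0 (sorted_eigenvalues A)).
- by rewrite inE sz.
- by rewrite inE sz; case: n A rA ltn {Asym sz}.
- by rewrite -ltnS prednK // (leq_ltn_trans _ ltn).
Qed.

(** Unitary diagonalization over [R[i]]: in the coordinates [w] of [v], both sides become sums
    weighted by the nonnegative numbers [w 0 i * (w 0 i)^*], so it suffices to bound each diagonal
    entry by the last eigenvalue. *)
Lemma rayleigh_le_last (R : rcfType) (n : nat) (A : 'M[R]_n) (v : 'rV[R]_n) :
  A^T = A ->
  (v *m A *m v^T) 0 0 <= nth 0 (eigenvalues A) n.-1 * (v *m v^T) 0 0.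
Proof.
move=> Asym; set t := nth _ _ _.
pose f : {rmorphism R -> R[i]} := real_complex R.
have fJ m p (M : 'M[R]_(m, p)) : (map_mx f M)^t* = map_mx f M^T.
  rewrite map_trmx -map_mx_comp; apply/matrixP => i j; rewrite !mxE /=.
  by rewrite conj_Creal //; apply/complex_realP; exists (M j i).
pose B := map_mx f A.
have Bh : B \is hermsymmx.
  by apply/is_hermitianmxP; rewrite expr0 scale1r fJ Asym.
have /orthomx_spectralP := hermitian_normalmx Bh.
have Dr := hermitian_spectral_diag_real Bh.
have Pu := spectral_unitarymx B.
set P := spectralmx B in Pu *; set D := spectral_diag B in Dr *.
rewrite invmx_unitary // => E.
have PP : P *m P^t* = 1%:M by apply/unitarymxP.
have PP' : P^t* *m P = 1%:M by rewrite -invmx_unitary // mulVmx // unitarymx_unit.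
(* Row [i] of the unitary matrix [P] is an eigenvector for [D 0 i], which is real because [B] is
   hermitian. *)
have Dt i : D 0 i <= f t.
  have /complex_realP[r Er] := mxOverP Dr 0 i.
  rewrite Er lecR; apply: eigenvalues_le_last => //.
  rewrite -(fmorph_root f) map_char_poly -/B -eigenvalue_root_char.
  apply/eigenvalueP; exists (row i P).
    rewrite E -row_mul !mulmxA PP mul1mx row_mul row_diag_mx -scalemxAl -rowE Er.
    exact: erefl.
  apply/eqP => P0; have /matrixP/(_ i i)/eqP := PP; apply/negP.
  have /rowP := row_mul i P (P^t*); rewrite P0 mul0mx => /(_ i).
  by rewrite !mxE eqxx => ->; rewrite eq_sym oner_eq0.
pose w := map_mx f v *m P^t*.
have wE : w^t* = P *m map_mx f v^T by rewrite trmx_mul map_mxM trmxCK fJ.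
have E1 : f ((v *m v^T) 0 0) = \sum_i w 0 i * (w 0 i)^*.
  transitivity ((w *m w^t*) 0 0).
    by rewrite wE mulmxA -[w *m P]mulmxA PP' mulmx1 -map_mxM [RHS]mxE.
  by rewrite mxE; apply: eq_bigr => i _; rewrite !mxE.
have E2 : f ((v *m A *m v^T) 0 0) = \sum_i D 0 i * (w 0 i * (w 0 i)^*).
  transitivity ((w *m diag_mx D *m w^t*) 0 0).
    rewrite wE mulmxA -[w *m _ *m P]mulmxA -[_ *m P^t* *m _]mulmxA.
    by rewrite [P^t* *m _]mulmxA -E -!map_mxM [RHS]mxE.
  rewrite mul_mx_diag mxE; apply: eq_bigr => i _.
  rewrite [X in X * _]mxE [w^t* _ _]mxE [w^T _ _]mxE.
  by rewrite [_ * D 0 i]mulrC mulrA.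
rewrite -lecR -[_%:C%C]/(f _) -[X in _ <= X]/(f _) rmorphM /= E1 E2 mulr_sumr.
by apply: ler_sum => i _; rewrite ler_wpM2r ?mul_conjC_ge0.
Qed.

Lemma card_nbh (G : sgraph) (v : G) : #|nbh v| = (\sum_u adj v u)%N.
Proof. by rewrite -sum1_card big_mkcond; apply: eq_bigr => u _; rewrite inE; case: adj. Qed.

(** This is the Rayleigh bound at D^{1/2} f. With no isolated vertex, D^{1/2} cancels the outer
    factors D^{-1/2}, and no square root survives. *)
Lemma rayleigh_norm_laplacian (R : rcfType) (G : sgraph) (f : G -> R) :
  no_isolated G ->
  \sum_v #|nbh v|%:R * f v ^+ 2 - \sum_u \sum_v (adj u v)%:R * (f u * f v)
    <= lambda R G #|G|.-1 * \sum_v #|nbh v|%:R * f v ^+ 2.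
Proof.
move=> iso; pose s (v : G) : R := Num.sqrt #|nbh v|%:R.
have s0 v : s v != 0 by rewrite sqrtr_eq0 -ltNge ltr0n card_gt0 iso.
have s2 v : s v ^+ 2 = #|nbh v|%:R by rewrite sqr_sqrtr ?ler0n.
pose w : 'rV[R]_#|G| := \row_i (s (enum_val i) * f (enum_val i)).
have := rayleigh_le_last w (norm_laplacian_sym R G).
have sumE (F : G -> R) : \sum_(i < #|G|) F (enum_val i) = \sum_v F v.
  by rewrite -(big_enum_val F).
have wD : w *m degmx_invsqrt R G = \row_i f (enum_val i).
  by apply/rowP => i; rewrite mul_mx_diag !mxE mulrAC mulfV ?mul1r.
have Dw : degmx_invsqrt R G *m w^T = (\row_i f (enum_val i))^T.
  by rewrite -wD trmx_mul tr_diag_mx.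
have -> : (w *m w^T) 0 0 = \sum_v #|nbh v|%:R * f v ^+ 2.
  by rewrite mxE -sumE; apply: eq_bigr => i _; rewrite !mxE -s2; ring.
suff -> : (w *m norm_laplacian R G *m w^T) 0 0 = \sum_v #|nbh v|%:R * f v ^+ 2
    - \sum_u \sum_v (adj u v)%:R * (f u * f v) by [].
rewrite mulmxBr mulmx1 mulmxBl [LHS]mxE; congr (_ + _).
  by rewrite mxE -sumE; apply: eq_bigr => i _; rewrite !mxE -s2; ring.
rewrite !mulmxA wD -mulmxA Dw [LHS]mxE; congr (- _).
rewrite exchange_big mxE -sumE; apply: eq_bigr => j _.
rewrite !mxE mulr_suml -sumE; apply: eq_bigr => i _; rewrite !mxE; ring.
Qed.

(** * Cardinalities and degrees across one time step *)

(** The body of [iim_step] with its witnesses as parameters, so that lemmas can refer to old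
    vertices and copies. *)
Definition iim_extension (G H : sgraph) (old copy : G -> H) : Prop :=
  [/\ injective old /\ injective copy,
      [disjoint codom old & codom copy]
        /\ (forall w : H, (w \in codom old) || (w \in codom copy)),
      forall u v : G, adj (old u) (old v) = adj u v
    & forall v : G, nbh (copy v) = old @: cnbh v
                 \/ nbh (copy v) = old @: (~: cnbh v)].

Lemma big_iim_extension (T : Type) (idx : T) (op : Monoid.com_law idx)
    (G H : sgraph) (old copy : G -> H) (F : H -> T) :
  iim_extension old copy ->
  \big[op/idx]_w F w
    = op (\big[op/idx]_v F (old v)) (\big[op/idx]_v F (copy v)).
Proof.
move=> [[iold icopy] [dis cov] _ _].
rewrite (bigID [in codom old]) /=; congr (op _ _).
  rewrite -big_uniq /=; last by rewrite map_inj_uniq ?enum_uniq.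
  by rewrite big_map big_enum.
rewrite (eq_bigl [in codom copy]) => [|w]; last first.
  apply/idP/idP => [|wc]; first by have:= cov w; case: (w \in codom old).
  by apply: contraL wc => wo; rewrite (disjointFr dis wo).
rewrite -big_uniq /=; last by rewrite map_inj_uniq ?enum_uniq.
by rewrite big_map big_enum.
Qed.

Lemma card_iim_extension (G H : sgraph) (old copy : G -> H) :
  iim_extension old copy -> #|H| = #|G|.*2.
Proof.
by move=> ext; rewrite -!sum1_card (big_iim_extension _ _ ext) /= addnn.
Qed.

Lemma iim_ltn_card (l : nat) (G H : sgraph) : iim l G H -> (l < #|H|)%N.
Proof.
elim: l H => [H ->|l IH H [G' /IH lt [old [copy ext]]]]; first exact: vertex_gt0.
by rewrite (card_iim_extension ext); lia.
Qed.

Lemma adj_copy_copy (G H : sgraph) (old copy : G -> H) (u v : G) :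
  iim_extension old copy -> adj (copy u) (copy v) = false.
Proof.
move=> [_ [dis _] _ nb]; have : copy v \notin codom old.
  by rewrite (disjointFl dis) ?codom_f.
apply: contraNF => uv; have : copy v \in nbh (copy u) by rewrite inE.
by case: (nb u) => ->; case/imsetP => w _ ->; apply: codom_f.
Qed.

(** The cases are clone and anticlone; the additive form of the second avoids truncated
    subtraction. *)
Lemma card_nbh_copy (G H : sgraph) (old copy : G -> H) (v : G) :
  iim_extension old copy ->
  #|nbh (copy v)| = #|nbh v|.+1 \/ (#|nbh (copy v)| + #|nbh v|.+1)%N = #|G|.
Proof.
move=> [[iold _] _ _ nb].
have cv : #|cnbh v| = #|nbh v|.+1 by rewrite cardsU1 inE adj_irr.
by case: (nb v) => ->; rewrite card_imset // -cv; [left|right; rewrite addnC cardsC].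
Qed.

Lemma card_nbh_old (G H : sgraph) (old copy : G -> H) (v : G) :
  iim_extension old copy ->
  #|nbh (old v)| = (#|nbh v| + \sum_u adj (old v) (copy u))%N.
Proof.
move=> ext; rewrite !card_nbh (big_iim_extension _ _ ext) /=; congr addn.
by case: ext => _ _ oo _; apply: eq_bigr => u _; rewrite oo.
Qed.

(** Copies are independent, so both sides count the edges between old vertices and copies. *)
Lemma sum_card_nbh_copy (G H : sgraph) (old copy : G -> H) :
  iim_extension old copy ->
  (\sum_v #|nbh (copy v)| = \sum_u \sum_v adj (old u) (copy v))%N.
Proof.
move=> ext; rewrite exchange_big; apply: eq_bigr => v _ /=.
rewrite card_nbh (big_iim_extension _ _ ext) /=.
rewrite [X in (_ + X)%N]big1 ?addn0; last by move=> u _; rewrite (adj_copy_copy _ _ ext).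
by apply: eq_bigr => u _; rewrite adj_sym.
Qed.

Lemma card_nbh_lt (G : sgraph) (v : G) : (#|nbh v| < #|G|)%N.
Proof.
have -> : #|nbh v|.+1 = #|cnbh v| by rewrite cardsU1 inE adj_irr.
exact: max_card.
Qed.

Lemma sum_card_nbh_gt0 (G H : sgraph) (h : G -> H) :
  no_isolated H -> (0 < \sum_v #|nbh (h v)|)%N.
Proof.
move=> iso; have /card_gt0P[v _] := vertex_gt0 G.
by rewrite (bigD1 v) //= ltn_addr // card_gt0.
Qed.

(** * Degree sums over the last two steps, and the spectral gap *)

Lemma vol_le_copies (G1 G2 H : sgraph) (old1 copy1 : G1 -> G2) (old copy : G2 -> H) :
  iim_extension old1 copy1 -> iim_extension old copy ->
  (1 < #|G1|)%N ->
  (\sum_(v : G2) #|nbh v| <= 14 * \sum_v #|nbh (copy v)|)%N.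
Proof.
move=> ext1 ext n1; have n2 := card_iim_extension ext1.
rewrite !(big_iim_extension _ _ ext1) /=.
pose e u := (\sum_v adj (old1 u) (copy1 v))%N.
(* The terms [e u] add up to the degrees of the new vertices of G2, so the debt
   [7 * e u] is repaid by seven times [Hcopy]. *)
have Hold u : (#|nbh (old1 u)| + e u <= 14 * #|nbh (copy (old1 u))| + 7 * e u)%N.
  have := card_nbh_old u ext1; rewrite -/(e u).
  have : (e u <= #|G1|)%N.
    by rewrite -sum1_card; apply: leq_sum => v _; case: adj.
  (* Only an anticlone needs care: if c is its degree, then [#|G1| <= c + e u], so the degree of
     [old1 u], being less than [#|G1| + e u], is less than [c + 2 * e u]. *)
  by have := card_nbh_lt u; have := card_nbh_copy (old1 u) ext; lia.
have Hcopy v : (#|nbh (copy1 v)| <= 2 * #|nbh (copy (copy1 v))|)%N.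
  have : (#|nbh (copy1 v)| <= #|G1|)%N.
    rewrite card_nbh (big_iim_extension _ _ ext1) /= [X in (_ + X)%N]big1 ?addn0.
      by rewrite -sum1_card; apply: leq_sum => u _; case: adj.
    by move=> u _; rewrite (adj_copy_copy _ _ ext1).
  (* An anticlone has degree at least [#|G1| - 1], which is at least half of [#|G1|] by [n1]. *)
  by have := card_nbh_copy (copy1 v) ext; lia.
have := leq_sum (index_enum _) (fun u (_ : predT u) => Hold u).
have := leq_sum (index_enum _) (fun v (_ : predT v) => Hcopy v).
rewrite !big_split /= !big1_eq -(sum_card_nbh_copy ext1); lia.
Qed.

Lemma spectral_gap_ge_copies (R : rcfType) (G H : sgraph) (old copy : G -> H) :
  iim_extension old copy -> no_isolated H ->
  let x := (\sum_v #|nbh (copy v)|)%N in let y := (\sum_(v : G) #|nbh v|)%N in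
  x%:R <= spectral_gap R H * (x + y)%:R.
Proof.
move=> ext iso /=.
set x := (\sum_v #|nbh (copy v)|)%N; set y := (\sum_(v : G) #|nbh v|)%N.
have cold v : copy v \notin codom old.
  by case: ext => _ [dis _] _ _; rewrite (disjointFl dis) ?codom_f.
pose f w : R := if w \in codom old then - x%:R else (x + y)%:R.
have fo v : f (old v) = - x%:R by rewrite /f codom_f.
have fc v : f (copy v) = (x + y)%:R by rewrite /f (negPf (cold v)).
have := rayleigh_norm_laplacian f iso; set t := lambda _ _ _.
have -> : \sum_v #|nbh v|%:R * f v ^+ 2 =
    (x + y)%:R * x%:R ^+ 2 + x%:R * (x + y)%:R ^+ 2 :> R.
  rewrite (big_iim_extension _ _ ext) /=; congr (_ + _).
    under eq_bigr => v _ do rewrite fo sqrrN (card_nbh_old _ ext).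
    by rewrite -mulr_suml -natr_sum big_split /= -(sum_card_nbh_copy ext) addnC.
  under eq_bigr => v _ do rewrite fc.
  by rewrite -mulr_suml -natr_sum.
have -> : \sum_u \sum_v (adj u v)%:R * (f u * f v) =
    y%:R * x%:R ^+ 2 - 2 * x%:R * (x%:R * (x + y)%:R) :> R.
  rewrite (big_iim_extension _ _ ext) /=.
  under eq_bigr => u _ do rewrite (big_iim_extension _ _ ext) /=.
  under [X in _ + X]eq_bigr => u _ do rewrite (big_iim_extension _ _ ext) /=.
  rewrite !big_split /=.
  have -> : \sum_u \sum_v (adj (old u) (old v))%:R * (f (old u) * f (old v)) =
      y%:R * x%:R ^+ 2 :> R.
    rewrite natr_sum mulr_suml; apply: eq_bigr => u _.
    rewrite card_nbh natr_sum mulr_suml; apply: eq_bigr => v _.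
    by rewrite !fo; case: ext => _ _ -> _; ring.
  have -> : \sum_u \sum_v (adj (old u) (copy v))%:R * (f (old u) * f (copy v)) =
      - (x%:R * (x%:R * (x + y)%:R)) :> R.
    rewrite {1}/x (sum_card_nbh_copy ext) natr_sum mulr_suml -sumrN.
    apply: eq_bigr => u _; rewrite natr_sum mulr_suml -sumrN.
    by apply: eq_bigr => v _; rewrite fo fc; ring.
  have -> : \sum_u \sum_v (adj (copy u) (old v))%:R * (f (copy u) * f (old v)) =
      - (x%:R * (x%:R * (x + y)%:R)) :> R.
    rewrite exchange_big {1}/x (sum_card_nbh_copy ext) natr_sum mulr_suml -sumrN.
    apply: eq_bigr => u _; rewrite natr_sum mulr_suml -sumrN.
    by apply: eq_bigr => v _; rewrite adj_sym fo fc; ring.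
  rewrite [X in _ + (_ + X)]big1 => [|u _]; first by ring.
  by rewrite big1 // => v _; rewrite (adj_copy_copy _ _ ext) mul0r.
move=> ray.
have tg : t - 1 <= spectral_gap R H by rewrite le_max (ler_norm (t - 1)) orbT.
have xR : (0 : R) < x%:R by rewrite ltr0n sum_card_nbh_gt0.
have yR : (0 : R) <= y%:R by rewrite ler0n.
apply: (@le_trans _ _ ((t - 1) * (x + y)%:R)); last by rewrite ler_wpM2r.
(* The Rayleigh inequality is the goal multiplied by this positive factor. *)
have pos : 0 < x%:R * (2 * x%:R + y%:R) :> R by nra.
rewrite -(ler_pM2r pos) -subr_ge0; move: ray; rewrite -subr_ge0 natrD.
by congr (_ <= _); ring.
Qed.

Unset Implicit Arguments.

Theorem theorem3p2 (R : rcfType) (G : sgraph) (l : nat) (H : sgraph) :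
  (4 <= l)%N -> iim l G H -> no_isolated H ->
  1 / 15%:R <= spectral_gap R H.
Proof.
(* The last two steps are split off; at least two steps precede [G1], which therefore has more than
   one vertex. *)
case: l => [|[|l]] // l4 [G2 [G1 /iim_ltn_card lt1 [old1 [copy1 ext1]]]].
move=> [old [copy ext]] iso.
have := vol_le_copies ext1 ext.
have := spectral_gap_ge_copies R ext iso => /=.
set x := (\sum_v #|nbh (copy v)|)%N; set y := (\sum_(v : G2) #|nbh v|)%N.
set g := spectral_gap R H => gx yx.
have {}yx : y%:R <= 14 * x%:R :> R.
  by rewrite -natrM ler_nat yx // (ltn_trans (_ : 1 < l)%N lt1).
have xR : (0 : R) < x%:R by rewrite ltr0n sum_card_nbh_gt0.
have yR : (0 : R) <= y%:R by rewrite ler0n.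
rewrite ler_pdivrMr ?ltr0n //; rewrite natrD in gx.
(* From [yx], x + y is at most 15 x; with [gx] and x > 0 this excludes [g * 15 < 1]. *)
by rewrite leNgt; apply/negP => g15; nra.
Qed.
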